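(* Let $\mathbb{X}$ be a classical restriction category. Then $\mathbb{X}$ has a unique override operator $\triangleright$, and it is given by $f\triangleright g:=f\vee\overline{f}^c g$ for $f,g\in\mathbb{X}(A,B)$. Moreover, its induced update operator, defined by $f\diamond g=\overline{f}(g\triangleright f)$, satisfies $f\diamond g=\overline{g}^c f\vee\overline{f}g$ for all $f,g\in\mathbb{X}(A,B)$.
   Context: Composition is written diagrammatically: for $f:A\to B$ and $g:B\to C$, $fg:A\to C$ is $f$ followed by $g$. Composition binds more tightly than all other binary operations. A restriction category is a category $\mathbb{X}$ equipped with operations $\overline{(-)}:\mathbb{X}(A,B)\to\mathbb{X}(A,A)$ for all objects $A,B$ such that: [R.1] $\overline{f}f=f$ for $f\in\mathbb{X}(A,B)$; [R.2] $\overline{f}\,\overline{g}=\overline{g}\,\overline{f}$ for $f\in\mathbb{X}(A,B)$, $g\in\mathbb{X}(A,C)$; [R.3] $\overline{\overline{f}g}=\overline{f}\,\overline{g}$ for $f\in\mathbb{X}(A,B)$, $g\in\mathbb{X}(A,C)$; [R.4] $f\overline{g}=\overline{fg}f$ for $f\in\mathbb{X}(A,B)$, $g\in\mathbb{X}(B,C)$. For $f,g\in\mathbb{X}(A,B)$: $f\le g$ means $\overline{f}g=f$ (this is a partial order on each homset); $f\smile g$ ($f$ and $g$ are compatible) means $\overline{g}f=\overline{f}g$. A restriction category has binary joins if for all $f,g\in\mathbb{X}(A,B)$ with $f\smile g$ there is a map $f\vee g\in\mathbb{X}(A,B)$ such that: [J.1] $f\le f\vee g$ and $g\le f\vee g$;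 [J.2] for any $h\in\mathbb{X}(A,B)$, if $f\le h$ and $g\le h$ then $f\vee g\le h$; [J.3] for any $k\in\mathbb{X}(A',A)$, $k(f\vee g)=kf\vee kg$. Joins are unique when they exist. A restriction category has restriction zero maps if for all objects $A,B$ there is $0_{A,B}\in\mathbb{X}(A,B)$ such that $\overline{0_{A,B}}=0_{A,A}$ and, for all objects $A,B,C,D$ and all $f\in\mathbb{X}(B,C)$, $0_{A,B}f=0_{A,C}$ and $f0_{C,D}=0_{B,D}$; zero maps are written $0$. In this case, $f,g\in\mathbb{X}(A,B)$ are disjoint, written $f\perp g$, if $\overline{f}g=0$ (equivalently $\overline{g}f=0$); disjoint maps are compatible. A classical restriction category is a restriction category with binary joins and restriction zero maps such that for all $f,g\in\mathbb{X}(A,B)$ with $f\le g$ there exists a (necessarily unique) map $g\backslash f\in\mathbb{X}(A,B)$ with $g\backslash f\perp f$ and $(g\backslash f)\vee f=g$. For $f\in\mathbb{X}(A,B)$ one always has $\overline{f}\le 1_A$, and the complement of $\overline{f}$ is $\overline{f}^c:=1_A\backslash\overline{f}\in\mathbb{X}(A,A)$. An override operator on a restriction category $\mathbb{X}$ is a family of binary operations $\triangleright:\mathbb{X}(A,B)\times\mathbb{X}(A,B)\to\mathbb{X}(A,B)$, for all objects $A,B$, such that: (1) $(f\triangleright g)\triangleright h=f\triangleright(g\triangleright h)$ for $f,g,h\in\mathbb{X}(A,B)$; (2) $f\triangleright\overline{f}g=f$ for $f,g\in\mathbb{X}(A,B)$; (3) $\overline{g}f\triangleright f=f$ for $f\in\mathbb{X}(A,B)$,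 $g\in\mathbb{X}(A,C)$; (4) $f(g\triangleright h)=fg\triangleright fh$ for $f\in\mathbb{X}(A,B)$, $g,h\in\mathbb{X}(B,C)$; (5) $\overline{f\triangleright g}\,h=\overline{f}h\triangleright\overline{g}h$ for $f,g\in\mathbb{X}(A,C)$, $h\in\mathbb{X}(A,B)$. *)

(* Defs.v *)
Set Implicit Arguments.
Unset Strict Implicit.
Unset Printing Implicit Defensive.

Declare Scope rcat_scope.
Open Scope rcat_scope.

Reserved Notation "f ;; g" (at level 40, left associativity).

Record category := Category {
  obj :> Type;
  hom : obj -> obj -> Type;
  idm : forall A, hom A A;
  comp : forall A B C, hom A B -> hom B C -> hom A C;
  comp_idl : forall A B (f : hom A B), comp (idm A) f = f;
  comp_idr : forall A B (f : hom A B), comp f (idm B) = f;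
  comp_assoc : forall A B C D (f : hom A B) (g : hom B C) (h : hom C D),
    comp f (comp g h) = comp (comp f g) h
}.

Arguments hom {c} A B.
Arguments idm {c} A.
Arguments comp {c A B C} f g.

(* Diagrammatic order: [f ;; g] is [f] followed by [g]. *)
Notation "f ;; g" := (comp f g) : rcat_scope.

Record restrictionCategory := RestrictionCategory {
  rc_cat :> category;
  rst : forall A B : rc_cat, hom A B -> hom A A;
  rst1 : forall (A B : rc_cat) (f : hom A B), rst f ;; f = f;
  rst2 : forall (A B C : rc_cat) (f : hom A B) (g : hom A C),
    rst f ;; rst g = rst g ;; rst f;
  rst3 : forall (A B C : rc_cat) (f : hom A B) (g : hom A C),
    rst (rst f ;; g) = rst f ;; rst g;
  rst4 : forall (A B C : rc_cat) (f : hom A B) (g : hom B C),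
    f ;; rst g = rst (f ;; g) ;; f
}.

Arguments rst {r A B} f.

Section Restriction.
Variable X : restrictionCategory.

Definition rle (A B : X) (f g : hom A B) : Prop := rst f ;; g = f.

Definition compatible (A B : X) (f g : hom A B) : Prop :=
  rst g ;; f = rst f ;; g.

Lemma rst_id (A : X) : rst (idm A) = idm A.
Proof. rewrite <- (comp_idr (rst (idm A))). apply rst1. Qed.

Lemma rst_rst (A B : X) (f : hom A B) : rst (rst f) = rst f.
Proof.
pose proof (rst3 f (idm A)) as E. now rewrite rst_id, !comp_idr in E.
Qed.

Lemma rst_le_id (A B : X) (f : hom A B) : rle (rst f) (idm A).
Proof. unfold rle. rewrite comp_idr. apply rst_rst. Qed.

Lemma compatible_compl (A A' B : X) (k : hom A' A) (f g : hom A B) :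
  compatible f g -> compatible (k ;; f) (k ;; g).
Proof.
unfold compatible; intros fg.
now rewrite !comp_assoc, <- !rst4, <- !comp_assoc, fg.
Qed.

End Restriction.

(* The join is a partial operation, hence its compatibility argument.  Its
   value does not depend on that proof, by [join_ubl], [join_ubr], [join_least]
   and antisymmetry of [rle]. *)
Record binaryJoins (X : restrictionCategory) := BinaryJoins {
  join_op : forall (A B : X) (f g : hom A B), compatible f g -> hom A B;
  join_ubl : forall (A B : X) (f g : hom A B) (c : compatible f g),
    rle f (join_op c);
  join_ubr : forall (A B : X) (f g : hom A B) (c : compatible f g),
    rle g (join_op c);
  join_least : forall (A B : X) (f g : hom A B) (c : compatible f g)
    (h : hom A B), rle f h -> rle g h -> rle (join_op c) h;
  join_precomp : forall (A A' B : X) (k : hom A' A) (f g : hom A B)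
    (c : compatible f g),
    k ;; join_op c = join_op (compatible_compl k c)
}.

Record restrictionZeros (X : restrictionCategory) := RestrictionZeros {
  zero_map : forall A B : X, hom A B;
  rst_zero : forall A B : X, rst (zero_map A B) = zero_map A A;
  zero_compl : forall (A B C : X) (f : hom B C),
    zero_map A B ;; f = zero_map A C;
  zero_compr : forall (B C D : X) (f : hom B C),
    f ;; zero_map C D = zero_map B D
}.

Definition disjoint (X : restrictionCategory) (Z : restrictionZeros X)
  (A B : X) (f g : hom A B) : Prop := rst f ;; g = zero_map Z A B.

Lemma disjoint_sym (X : restrictionCategory) (Z : restrictionZeros X)
  (A B : X) (f g : hom A B) : disjoint Z f g -> disjoint Z g f.
Proof.
unfold disjoint; intros fg.
now rewrite <- (rst1 f), comp_assoc, rst2, <- rst3, fg, rst_zero, zero_compl.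
Qed.

Lemma disjoint_compatible (X : restrictionCategory) (Z : restrictionZeros X)
  (A B : X) (f g : hom A B) : disjoint Z f g -> compatible f g.
Proof.
intros fg. pose proof (disjoint_sym fg) as gf.
unfold compatible, disjoint in *. now rewrite fg, gf.
Qed.

(* [rcompl_op] at [f], [g] and a proof of [rle f g] is the relative
   complement g \ f. *)
Record classicalRestrictionCategory := ClassicalRestrictionCategory {
  crc_rc :> restrictionCategory;
  crc_joins : binaryJoins crc_rc;
  crc_zeros : restrictionZeros crc_rc;
  rcompl_op : forall (A B : crc_rc) (f g : hom A B), rle f g -> hom A B;
  rcompl_disjoint : forall (A B : crc_rc) (f g : hom A B) (le_fg : rle f g),
    disjoint crc_zeros (rcompl_op le_fg) f;
  rcompl_join : forall (A B : crc_rc) (f g : hom A B) (le_fg : rle f g),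
    join_op crc_joins (disjoint_compatible (rcompl_disjoint le_fg)) = g
}.

Section Classical.
Variable X : classicalRestrictionCategory.

Definition join (A B : X) (f g : hom A B) (c : compatible f g) : hom A B :=
  join_op (crc_joins X) c.

Definition rstc (A B : X) (f : hom A B) : hom A A :=
  rcompl_op (rst_le_id f).

Lemma rst_rstc_comp (A B C : X) (f : hom A B) (g : hom A C) :
  rst f ;; (rstc f ;; g) = zero_map (crc_zeros X) A C.
Proof.
pose proof (disjoint_sym (rcompl_disjoint (rst_le_id f))) as d.
unfold disjoint in d. rewrite rst_rst in d.
unfold rstc. now rewrite comp_assoc, d, zero_compl.
Qed.

(* The joins  f \/ (rstc f ;; g)  and  (rstc g ;; f) \/ (rst f ;; g)  exist. *)
Lemma compatible_override (A B : X) (f g : hom A B) :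
  compatible f (rstc f ;; g).
Proof. exact (disjoint_compatible (rst_rstc_comp f g)). Qed.

Lemma compatible_update (A B : X) (f g : hom A B) :
  compatible (rstc g ;; f) (rst f ;; g).
Proof.
apply (@disjoint_compatible _ (crc_zeros X)), disjoint_sym; unfold disjoint.
now rewrite rst3, <- comp_assoc, rst_rstc_comp, zero_compr.
Qed.

End Classical.

Arguments join {X A B} f g c.

Definition homBinop (X : restrictionCategory) : Type :=
  forall A B : X, hom A B -> hom A B -> hom A B.

Record isOverride (X : restrictionCategory) (ov : homBinop X) : Prop :=
  IsOverride {
  ov_assoc : forall (A B : X) (f g h : hom A B),
    ov A B (ov A B f g) h = ov A B f (ov A B g h);
  ov_rstl : forall (A B : X) (f g : hom A B), ov A B f (rst f ;; g) = f;
  ov_rstr : forall (A B C : X) (f : hom A B) (g : hom A C),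
    ov A B (rst g ;; f) f = f;
  ov_comp : forall (A B C : X) (f : hom A B) (g h : hom B C),
    f ;; ov B C g h = ov A C (f ;; g) (f ;; h);
  ov_rst : forall (A B C : X) (f g : hom A C) (h : hom A B),
    rst (ov A C f g) ;; h = ov A B (rst f ;; h) (rst g ;; h)
}.

Definition update (X : restrictionCategory) (ov : homBinop X)
  (A B : X) (f g : hom A B) : hom A B := rst f ;; ov A B g f.

(* Main.v *)
(* Every map [h] out of [A] is the join of its restrictions along the idempotent
   [rst f] and its complement [rstc f], so [h] is determined by [rst f ;; h] and
   [rstc f ;; h].  The value at [f], [g] of any override operator is the map [h]
   with [rst f ;; h = f] and [rstc f ;; h = rstc f ;; g].  All equations are
   checked by splitting along suitable complementary idempotents. *)
From Stdlib Require Import Setoid.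
Require Import Defs.

Section Override.
Set Implicit Arguments.
Unset Strict Implicit.
Variable X : classicalRestrictionCategory.

Local Notation zero A B := (zero_map (crc_zeros X) A B).

(** * The restriction order and joins as least upper bounds *)

Lemma rle_antisym (A B : X) (f g : hom A B) : rle f g -> rle g f -> f = g.
Proof.
unfold rle; intros fg gf.
now rewrite <- fg, <- gf, comp_assoc, rst2, <- comp_assoc, rst1.
Qed.

Lemma rle_rst_comp (A B C : X) (f : hom A C) (g : hom A B) :
  rle (rst f ;; g) g.
Proof. unfold rle. now rewrite rst3, <- comp_assoc, rst1. Qed.

Lemma join_unique (A B : X) (f g h : hom A B) (c : compatible f g) :
  rle f h -> rle g h ->
  (forall k : hom A B, rle f k -> rle g k -> rle h k) ->
  join f g c = h.
Proof.
intros fh gh least. apply rle_antisym.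
- now apply join_least.
- apply least; [apply join_ubl | apply join_ubr].
Qed.

(** The types of [c] and [c'] depend on the joined maps, so the equality is obtained from the
    universal property instead of by comparing the proofs. *)
Lemma join_irrelevant (A B : X) (f g f' g' : hom A B)
    (c : compatible f g) (c' : compatible f' g') :
  f = f' -> g = g' -> join f g c = join f' g' c'.
Proof.
intros -> ->. apply join_unique.
- apply join_ubl.
- apply join_ubr.
- intros k. apply join_least.
Qed.

Lemma rle_refl (A B : X) (f : hom A B) : rle f f.
Proof. apply rst1. Qed.

Lemma rle_zero (A B : X) (f : hom A B) : rle (zero A B) f.
Proof. unfold rle. now rewrite rst_zero, zero_compl. Qed.

Lemma join_zerol (A B : X) (f g : hom A B) (c : compatible f g) :
  f = zero A B -> join f g c = g.
Proof.
intros ->. apply join_unique; auto using rle_zero, rle_refl.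
Qed.

Lemma join_zeror (A B : X) (f g : hom A B) (c : compatible f g) :
  g = zero A B -> join f g c = f.
Proof.
intros ->. apply join_unique; auto using rle_zero, rle_refl.
Qed.

Lemma comp_join (A A' B : X) (k : hom A' A) (f g : hom A B)
    (c : compatible f g) :
  k ;; join f g c = join (k ;; f) (k ;; g) (compatible_compl k c).
Proof. apply join_precomp. Qed.

(** * Algebra of [rst f] and [rstc f] as commuting idempotents *)

Lemma rst_rstc (A B : X) (f : hom A B) : rst (rstc f) = rstc f.
Proof.
(* [rstc f] is a joinand of the identity, and lying below the identity means being its own
   restriction. *)
pose proof (join_ubl (crc_joins X)
  (disjoint_compatible (rcompl_disjoint (rst_le_id f)))) as H.
unfold rle in H. rewrite rcompl_join, comp_idr in H. exact H.
Qed.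

Lemma rstC (A B C D : X) (f : hom A B) (g : hom A C) (h : hom A D) :
  rst f ;; (rst g ;; h) = rst g ;; (rst f ;; h).
Proof. now rewrite !comp_assoc, (rst2 f g). Qed.

Lemma rst_rstcC (A B C D : X) (f : hom A B) (g : hom A C) (h : hom A D) :
  rst f ;; (rstc g ;; h) = rstc g ;; (rst f ;; h).
Proof. rewrite <- (rst_rstc g). apply rstC. Qed.

Lemma rstcC (A B C D : X) (f : hom A B) (g : hom A C) (h : hom A D) :
  rstc f ;; (rstc g ;; h) = rstc g ;; (rstc f ;; h).
Proof. rewrite <- (rst_rstc f). apply rst_rstcC. Qed.

Lemma rstc_rst_comp (A B C : X) (f : hom A B) (g : hom A C) :
  rstc f ;; (rst f ;; g) = zero A C.
Proof. rewrite <- rst_rstcC. apply rst_rstc_comp. Qed.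

Lemma rstc_self (A B : X) (f : hom A B) : rstc f ;; f = zero A B.
Proof. rewrite <- (rst1 f) at 2. apply rstc_rst_comp. Qed.

Lemma rst_idem_comp (A B C : X) (f : hom A B) (g : hom A C) :
  rst f ;; (rst f ;; g) = rst f ;; g.
Proof. now rewrite comp_assoc, <- rst3, rst1. Qed.

Lemma rstc_idem_comp (A B C : X) (f : hom A B) (g : hom A C) :
  rstc f ;; (rstc f ;; g) = rstc f ;; g.
Proof. rewrite <- (rst_rstc f). apply rst_idem_comp. Qed.

Lemma rst_comp_rstcl (A B C : X) (f : hom A B) (g : hom A C) :
  rst (rstc f ;; g) = rstc f ;; rst g.
Proof. now rewrite <- (rst_rstc f), rst3. Qed.

(** * Splitting maps along complementary idempotents *)

Lemma comp_split (A B C : X) (k : hom A B) (g : hom B C) :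
  exists c : compatible (k ;; rstc g) (k ;; rst g),
    join (k ;; rstc g) (k ;; rst g) c = k.
Proof.
eexists (compatible_compl k _). unfold join. rewrite <- join_precomp.
unfold rstc. rewrite rcompl_join. apply comp_idr.
Qed.

Lemma comp_rstc_absorb (A B C : X) (k : hom A B) (g : hom B C) :
  k ;; rst g = zero A B -> k ;; rstc g = k.
Proof.
intros kg. destruct (comp_split k g) as [c E].
rewrite <- E at 2. symmetry. now apply join_zeror.
Qed.

Lemma rle_rst (A B : X) (f h : hom A B) : rle f h -> rst h ;; rst f = rst f.
Proof. unfold rle; intros fh. now rewrite rst2, <- rst3, fh. Qed.

Lemma compatible_split (A B C : X) (f : hom A B) (h : hom A C) :
  compatible (rst f ;; h) (rstc f ;; h).
Proof.
apply (@disjoint_compatible _ (crc_zeros X)); unfold disjoint.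
now rewrite rst3, <- comp_assoc, (rst_rstcC h f h), rst_rstc_comp.
Qed.

(** The join axioms distribute composition over joins on the left only; here [h] stands on the right
    of the split identity. Since the join lies below [h], it suffices to compare restrictions, and
    these can be split on the left by [comp_split]. *)
Lemma join_split (A B C : X) (f : hom A B) (h : hom A C) :
  join (rst f ;; h) (rstc f ;; h) (compatible_split f h) = h.
Proof.
set (j := join _ _ _).
assert (jh : rle j h).
{ apply join_least.
  - apply rle_rst_comp.
  - rewrite <- (rst_rstc f). apply rle_rst_comp. }
assert (e1 : rst j ;; (rst f ;; rst h) = rst f ;; rst h).
{ rewrite <- rst3. apply rle_rst, join_ubl. }
assert (e2 : rst j ;; (rstc f ;; rst h) = rstc f ;; rst h).
{ rewrite <- rst_comp_rstcl. apply rle_rst, join_ubr. }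
(* The domain of [h] lies in that of [j]: both sides are split along [f], and the pieces agree by
   [e2] and [e1]. *)
assert (E : rst h ;; rst j = rst h).
{ destruct (comp_split (rst h) f) as [c Ec].
  destruct (comp_split (rst h ;; rst j) f) as [d Ed].
  rewrite <- Ec at 2. rewrite <- Ed. apply join_irrelevant.
  - rewrite <- (rst_rstc f), <- comp_assoc, rstC, !(rst2 h), rst_rstc.
    exact e2.
  - rewrite <- comp_assoc, rstC, !(rst2 h). exact e1. }
unfold rle in jh. rewrite <- jh.
rewrite <- (rst1 h), comp_assoc, (rst2 j), E. reflexivity.
Qed.

Lemma rst_rstc_ext (A B C : X) (f : hom A B) (h k : hom A C) :
  rst f ;; h = rst f ;; k -> rstc f ;; h = rstc f ;; k -> h = k.
Proof.
intros E Ec. rewrite <- (join_split f h), <- (join_split f k).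
now apply join_irrelevant.
Qed.

(** * The override operator and its characterisation by two restrictions *)

Definition override : homBinop X :=
  fun A B f g => join f (rstc f ;; g) (compatible_override f g).

(** Unfolded, this is the upper bound property [rle f (override f g)]. *)
Lemma rst_override (A B : X) (f g : hom A B) : rst f ;; override f g = f.
Proof. apply join_ubl. Qed.

Lemma rstc_override (A B : X) (f g : hom A B) :
  rstc f ;; override f g = rstc f ;; g.
Proof.
unfold override. rewrite comp_join, join_zerol.
- apply rstc_idem_comp.
- apply rstc_self.
Qed.

Lemma override_unique (A B : X) (f g h : hom A B) :
  rst f ;; h = f -> rstc f ;; h = rstc f ;; g -> h = override f g.
Proof.
intros E Ec. apply (rst_rstc_ext (f := f)).
- now rewrite rst_override.
- now rewrite rstc_override.
Qed.

Lemma rst_rst_override (A B : X) (f g : hom A B) :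
  rst f ;; rst (override f g) = rst f.
Proof. now rewrite <- rst3, rst_override. Qed.

Lemma rstc_rst_override (A B : X) (f g : hom A B) :
  rstc f ;; rst (override f g) = rstc f ;; rst g.
Proof. now rewrite <- !rst_comp_rstcl, rstc_override. Qed.

(** * The override axioms *)

Lemma override_assoc (A B : X) (f g h : hom A B) :
  override (override f g) h = override f (override g h).
Proof.
set (fg := override f g).
(* Three pieces remain: on [rst f] the value is [f], on [rstc f ;; rst g] it is that of [g], and on
   [rstc f ;; rstc g] that of [h]. *)
apply override_unique; [|apply (rst_rstc_ext (f := g))].
- rewrite <- (rst_rst_override f g); fold fg.
  now rewrite <- comp_assoc, rst_override; apply rst_override.
- rewrite !rst_rstcC, rst_override, comp_assoc.
  rewrite <- rstc_rst_override; fold fg.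
  now rewrite <- comp_assoc, rst_override; apply rstc_override.
- rewrite (rstcC g f (override g h)), rstc_override.
  (* Outside the domains of [f] and [g], one is outside the domain of [fg]. *)
  assert (E : rstc g ;; rstc f ;; rstc fg = rstc g ;; rstc f).
  { apply comp_rstc_absorb. rewrite <- comp_assoc. unfold fg.
    now rewrite rstc_rst_override, rstcC, <- (comp_idr (rst g)),
      rstc_rst_comp, zero_compr. }
  now rewrite comp_assoc, <- E, <- comp_assoc, rstc_override,
    comp_assoc, E, <- comp_assoc, rstcC.
Qed.

(** Off the domain of [f ;; g], the map [f] lands off the domain of [g]: by [R.4], [f ;; rst g]
    equals [rst (f ;; g) ;; f], which [rstc (f ;; g)] kills. *)
Lemma rstc_comp (A B C D : X) (f : hom A B) (g : hom B C) (h : hom B D) :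
  rstc (f ;; g) ;; (f ;; (rstc g ;; h)) = rstc (f ;; g) ;; (f ;; h).
Proof.
assert (E : rstc (f ;; g) ;; f ;; rstc g = rstc (f ;; g) ;; f).
{ apply comp_rstc_absorb.
  now rewrite <- comp_assoc, rst4, rstc_rst_comp. }
now rewrite !comp_assoc, E.
Qed.

Lemma override_comp (A B C : X) (f : hom A B) (g h : hom B C) :
  f ;; override g h = override (f ;; g) (f ;; h).
Proof.
apply override_unique.
- now rewrite comp_assoc, <- rst4, <- comp_assoc, rst_override.
- now rewrite <- rstc_comp, rstc_override, rstc_comp.
Qed.

Lemma override_rst (A B C : X) (f g : hom A C) (h : hom A B) :
  rst (override f g) ;; h = override (rst f ;; h) (rst g ;; h).
Proof.
apply override_unique; [|apply (rst_rstc_ext (f := f))].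
- now rewrite rst3, <- comp_assoc, (rstC h), rst1, comp_assoc,
    rst_rst_override.
(* On [rst f] both sides vanish, as [rst f ;; h] is killed by its own complement; [p] stands for
   [override f g] and for [g]. *)
- assert (E : forall p : hom A C,
      rst f ;; (rstc (rst f ;; h) ;; (rst p ;; h)) = zero A B).
  { intros p.
    now rewrite rst_rstcC, rstC, <- rst_rstcC, rstc_self, zero_compr. }
  now rewrite !E.
- now rewrite !(rstcC f), (comp_assoc (rstc f)), rstc_rst_override,
    <- (comp_assoc (rstc f)).
Qed.

Lemma override_isOverride : isOverride override.
Proof.
split.
- exact override_assoc.
- intros A B f g. symmetry. apply override_unique.
  + apply rst1.
  + now rewrite rstc_self, rstc_rst_comp.
- intros A B C f g. symmetry. apply override_unique; [|reflexivity].
  now rewrite rst3, <- comp_assoc, rst1.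
- exact override_comp.
- exact override_rst.
Qed.

(** * Uniqueness, and the induced update *)

Lemma isOverride_eq (ov : homBinop X) (A B : X) (f g : hom A B) :
  isOverride ov -> ov A B f g = override f g.
Proof.
intros H. apply override_unique.
- now rewrite (ov_comp H), rst1, (ov_rstl H).
- rewrite (ov_comp H), rstc_self.
  (* Taking a zero map as the restricting map makes zero a left unit for [ov]. *)
  pose proof (ov_rstr H (rstc f ;; g) (zero A B)) as E.
  now rewrite rst_zero, zero_compl in E.
Qed.

Lemma update_override (A B : X) (f g : hom A B) :
  update override f g = join (rstc g ;; f) (rst f ;; g) (compatible_update f g).
Proof.
(* The split is along [g], the first argument of the override; each half kills one joinand, leaving
   [rst f ;; g] on [rst g] and [rstc g ;; f] on [rstc g]. *)
unfold update. apply (rst_rstc_ext (f := g)); rewrite comp_join.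
- rewrite join_zerol by apply rst_rstc_comp.
  now rewrite !(rstC g), rst_override, rst1.
- rewrite join_zeror by now rewrite <- rst_rstcC, rstc_self, zero_compr.
  now rewrite <- rst_rstcC, rstc_override, rst_rstcC, rst1, rstc_idem_comp.
Qed.

End Override.

Theorem theorem43 (X : classicalRestrictionCategory) :
  exists ov : homBinop X,
    isOverride ov /\
    (forall ov' : homBinop X, isOverride ov' ->
       forall (A B : X) (f g : hom A B), ov' A B f g = ov A B f g) /\
    (forall (A B : X) (f g : hom A B),
       ov A B f g = join f (rstc f ;; g) (compatible_override f g)) /\
    (forall (A B : X) (f g : hom A B),
       update ov f g = join (rstc g ;; f) (rst f ;; g) (compatible_update f g)).
Proof.
exists (@override X). split; [|split; [|split]].
- apply override_isOverride.
- intros ov' H A B f g. now apply isOverride_eq.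
- reflexivity.
- intros A B f g. apply update_override.
Qed.
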